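(* Let $\Bbbk$ be a field with $\operatorname{char}\Bbbk=0$ and let $A$ be a split semisimple $\Bbbk$-algebra with Frobenius trace form $\lambda$. Let $c_\lambda\in A\otimes_\Bbbk A$ be the Casimir element and $\gamma_\lambda$ the Casimir trace of $(A,\lambda)$. Assume that $\gamma_\lambda(1)\in\mathbb{Z}$. Then the following are equivalent: (i) the degree (that is, the $\Bbbk$-dimension) of every irreducible representation of $A$ divides $\gamma_\lambda(1)$; (ii) the Casimir element $c_\lambda$ is integral over $\mathbb{Z}$.
   Context: Algebras are associative and unital over the field $\Bbbk$; $\mathscr{Z}A$ is the center of $A$; $\langle\cdot,\cdot\rangle$ is the evaluation pairing $A^*\times A\to\Bbbk$, where $A^*=\operatorname{Hom}_\Bbbk(A,\Bbbk)$. A Frobenius (trace) form for a finite-dimensional algebra $A$ is a linear form $\lambda \in A^*$ with $\langle\lambda,ab\rangle=\langle\lambda,ba\rangle$ for all $a,b\in A$ that does not vanish on any nonzero ideal of $A$. The Casimir element of $(A,\lambda)$ is the unique element $c_\lambda=\sum_i x_i\otimes y_i \in A\otimes_\Bbbk A$ such that $a=\sum_i x_i\langle\lambda,ay_i\rangle$ for all $a\in A$; equivalently, one may take $\{x_i\}$ to be a $\Bbbk$-basis of $A$ and $\{y_i\}$ the basis with $\langle\lambda,x_iy_j\rangle=\delta_{i,j}$. The Casimir trace is the map $\gamma_\lambda\colon A\to \mathscr{Z}A$, $\gamma_\lambda(a)=\sum_i x_iay_i$. The condition $\gamma_\lambda(1)\in\mathbb{Z}$ means that $\gamma_\lambda(1)$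 is an integer multiple of $1_A$. A semisimple $\Bbbk$-algebra $A$ (here finite-dimensional) is split if $\operatorname{End}_A(S)=\Bbbk$ for every irreducible representation $S$ of $A$. An element $r$ of a ring $R$ is integral over a subring $Z$ of the center of $R$ if $r$ satisfies a monic polynomial with coefficients in $Z$; in (ii) the ring is $R=A\otimes_\Bbbk A$ and $Z=\mathbb{Z}$. *)

(* Defs.v *)
From HB Require Import structures.
From mathcomp Require Import all_boot all_order all_algebra all_field.

Set Implicit Arguments.
Unset Strict Implicit.
Unset Printing Implicit Defensive.

Import GRing.Theory.
Local Open Scope ring_scope.

(* The tensor product of two algebras, in coordinates: the (i, j) entry of a
   tensor is its coefficient on the pure tensor of the i-th and j-th vectors
   of the bases vbasis {:A} and vbasis {:B}.  The product is the bilinear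
   extension of the componentwise product of pure tensors (tensM). *)
Definition tensor (F : fieldType) (A B : falgType F) : Type :=
  'M[F]_(\dim {:A}, \dim {:B}).

Section TensorSpace.
Variables (F : fieldType) (A B : falgType F).

HB.instance Definition _ := Vector.copy (tensor A B) 'M[F]_(\dim {:A}, \dim {:B}).

Definition tens (a : A) (b : B) : tensor A B :=
  \matrix_(i, j) (coord (vbasis {:A}) i a * coord (vbasis {:B}) j b).

(* The linear map on A (x) B that extends f when f is bilinear, see
   tens_lift_tens. *)
Definition tens_lift (V : lmodType F) (f : A -> B -> V) (t : tensor A B) : V :=
  \sum_i \sum_j t i j *: f (vbasis {:A})`_i (vbasis {:B})`_j.

Lemma tens_linl b : linear (tens^~ b).
Proof. by move=> k x y; apply/matrixP=> i j; rewrite !mxE linearP mulrDl mulrA. Qed.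

Lemma tens_linr a : linear (tens a).
Proof. by move=> k x y; apply/matrixP=> i j; rewrite !mxE linearP mulrDr mulrCA. Qed.

Lemma tens_lift_linear (V : lmodType F) (f : A -> B -> V) : linear (tens_lift f).
Proof.
move=> k s t; rewrite /tens_lift scaler_sumr -big_split; apply: eq_bigr => i _ /=.
rewrite scaler_sumr -big_split; apply: eq_bigr => j _ /=.
by rewrite !mxE scalerDl scalerA.
Qed.

HB.instance Definition _ (V : lmodType F) (f : A -> B -> V) :=
  GRing.isLinear.Build F (tensor A B) V _ (tens_lift f) (tens_lift_linear f).

Lemma eq_tens_lift (V : lmodType F) (f g : A -> B -> V) :
  (forall a b, f a b = g a b) -> tens_lift f =1 tens_lift g.
Proof. by move=> fg t; do 2!apply: eq_bigr => ? _; rewrite fg. Qed.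

Lemma tens_lift_linear_fun (V : lmodType F) (f g : A -> B -> V) k t :
  tens_lift (fun a b => k *: f a b + g a b) t
    = k *: tens_lift f t + tens_lift g t.
Proof.
rewrite /tens_lift scaler_sumr -big_split; apply: eq_bigr => i _ /=.
rewrite scaler_sumr -big_split; apply: eq_bigr => j _ /=.
by rewrite scalerDr !scalerA mulrC.
Qed.

Lemma tens_lift_tens (V : lmodType F) (f : A -> B -> V) a b :
  (forall y, linear (f^~ y)) -> (forall x, linear (f x)) ->
  tens_lift f (tens a b) = f a b.
Proof.
move=> fl fr.
pose gl y : {linear A -> V} :=
  HB.pack (f^~ y) (GRing.isLinear.Build _ _ _ _ _ (fl y)).
pose gr x : {linear B -> V} :=
  HB.pack (f x) (GRing.isLinear.Build _ _ _ _ _ (fr x)).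
rewrite -[RHS]/(gl b a) [X in gl b X](coord_vbasis (memvf a)) linear_sum.
apply: eq_bigr => i _; rewrite linearZ /=.
rewrite -[f _ b]/(gr _ b) [X in gr _ X](coord_vbasis (memvf b)) linear_sum.
by rewrite scaler_sumr; apply: eq_bigr => j _; rewrite linearZ /= scalerA mxE.
Qed.

Lemma coord_vbasis_nth (C : falgType F) (i j : 'I_(\dim {:C})) :
  coord (vbasis {:C}) i (vbasis {:C})`_j = (i == j)%:R.
Proof. by rewrite coord_free ?(basis_free (vbasisP _)) 1?eq_sym. Qed.

Lemma tens_decomp (t : tensor A B) : t = tens_lift tens t.
Proof.
apply/matrixP=> k l; rewrite /tens_lift summxE (bigD1 k) //= summxE (bigD1 l) //=.
rewrite !mxE !coord_vbasis_nth !eqxx !mulr1 !big1 ?addr0 // => [i ik|j jl].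
  rewrite summxE big1 // => j _.
  by rewrite !mxE !coord_vbasis_nth eq_sym (negPf ik) mul0r mulr0.
by rewrite !mxE !coord_vbasis_nth (eq_sym l) (negPf jl) !mulr0.
Qed.

Lemma tens_ext (V : lmodType F) (f g : {linear tensor A B -> V}) :
  (forall a b, f (tens a b) = g (tens a b)) -> f =1 g.
Proof.
move=> fg t; rewrite (tens_decomp t) /tens_lift !linear_sum.
apply: eq_bigr => i _; rewrite !linear_sum; apply: eq_bigr => j _.
by rewrite !linearZ /= fg.
Qed.

End TensorSpace.

Section TensorAlgebra.
Variables (F : fieldType) (A B : falgType F).
Local Notation T := (tensor A B).

Definition tens_mul (s t : T) : T :=
  tens_lift (fun a b => tens_lift (fun a' b' => tens (a * a') (b * b')) t) s.

Lemma tens_mul_linl t : linear (tens_mul^~ t).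
Proof. by move=> k x y; rewrite /tens_mul linearP. Qed.

Lemma tens_mul_linr s : linear (tens_mul s).
Proof.
move=> k x y; rewrite /tens_mul -tens_lift_linear_fun.
by apply: eq_tens_lift => a b; rewrite linearP.
Qed.

HB.instance Definition _ s :=
  GRing.isLinear.Build F T T _ (tens_mul s) (tens_mul_linr s).

Definition tens_mulr t s := tens_mul s t.
HB.instance Definition _ t :=
  GRing.isLinear.Build F T T _ (tens_mulr t) (tens_mul_linl t).

Lemma tens_mul_tens a a' b b' :
  tens_mul (tens a b) (tens a' b') = tens (a * a') (b * b').
Proof.
have H x y : tens_lift (fun u v => tens (x * u) (y * v)) (tens a' b')
           = tens (x * a') (y * b').
  rewrite (tens_lift_tens (f := fun u v => tens (x * u) (y * v))) //.
    by move=> v k u1 u2; rewrite mulrDr -scalerAr tens_linl.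
  by move=> u k v1 v2; rewrite mulrDr -scalerAr tens_linr.
rewrite /tens_mul (eq_tens_lift H).
rewrite (tens_lift_tens (f := fun x y => tens (x * a') (y * b'))) //.
  by move=> y k u v; rewrite mulrDl -scalerAl tens_linl.
by move=> x k u v; rewrite mulrDl -scalerAl tens_linr.
Qed.

Lemma tens_mulA : associative tens_mul.
Proof.
move=> s t u.
rewrite -[LHS]/((tens_mulr (tens_mul t u)) s).
rewrite -[RHS]/((tens_mulr u \o tens_mulr t) s).
move: s; apply: tens_ext => a b /=; rewrite /tens_mulr.
rewrite -[LHS]/((tens_mul (tens a b) \o tens_mulr u) t).
rewrite -[RHS]/((tens_mulr u \o tens_mul (tens a b)) t).
move: t; apply: tens_ext => a1 b1 /=; rewrite /tens_mulr.
rewrite -[LHS]/((tens_mul (tens a b) \o tens_mul (tens a1 b1)) u).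
by move: u; apply: tens_ext => a2 b2 /=; rewrite !tens_mul_tens !mulrA.
Qed.

Lemma tens_mul1 : left_id (tens 1 1) tens_mul.
Proof.
move=> t; rewrite -[RHS]/(idfun t); move: t.
by apply: tens_ext => a b /=; rewrite tens_mul_tens !mul1r.
Qed.

Lemma tens_mulr1 : right_id (tens 1 1) tens_mul.
Proof.
move=> t; rewrite -[RHS]/(idfun t) -[LHS]/(tens_mulr (tens 1 1) t); move: t.
by apply: tens_ext => a b /=; rewrite /tens_mulr tens_mul_tens !mulr1.
Qed.

Lemma tens_mulDl : left_distributive tens_mul +%R.
Proof. by move=> s t u; exact: (linearD (tens_mulr u)). Qed.

Lemma tens_mulDr : right_distributive tens_mul +%R.
Proof. by move=> s t u; exact: (linearD (tens_mul s)). Qed.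

Lemma tens1_neq0 : tens 1 1 != 0 :> T.
Proof.
have nz (C : falgType F) : exists i, coord (vbasis {:C}) i 1 != 0.
  apply/existsP; rewrite -[X in is_true X]negbK; apply/negP=> /existsPn h.
  have /eqP[] := oner_neq0 C; rewrite (coord_vbasis (memvf 1)) big1 // => i _.
  by move: (h i); rewrite negbK => /eqP->; rewrite scale0r.
have [[i hi] [j hj]] := (nz A, nz B).
apply/eqP=> /matrixP/(_ i j); rewrite !mxE => /eqP.
by rewrite mulf_eq0 (negPf hi) (negPf hj).
Qed.

HB.instance Definition _ := GRing.Zmodule_isNzRing.Build T
  tens_mulA tens_mul1 tens_mulr1 tens_mulDl tens_mulDr tens1_neq0.

Lemma tensM a a' b b' : tens a b * tens a' b' = tens (a * a') (b * b') :> T.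
Proof. exact: tens_mul_tens. Qed.

Lemma tens_scaleAl k (s t : T) : k *: (s * t) = k *: s * t.
Proof. by symmetry; apply: (linearZ_LR (tens_mulr t)). Qed.

Lemma tens_scaleAr k (s t : T) : k *: (s * t) = s * (k *: t).
Proof. by symmetry; apply: (linearZ_LR (tens_mul s)). Qed.

HB.instance Definition _ := GRing.Lmodule_isLalgebra.Build F T tens_scaleAl.
HB.instance Definition _ := GRing.Lalgebra_isAlgebra.Build F T tens_scaleAr.
HB.instance Definition _ := Algebra_isFalgebra.Build F T.

End TensorAlgebra.

Section Representations.
Variables (F : fieldType) (A : falgType F).

(* Representations on finite-dimensional spaces; since A is finite-dimensional
   this covers all irreducible ones, which are quotients of the regular one. *)
Record representation (V : vectType F) := Representation {
  rep_fun :> {linear A -> 'End(V)};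
  rep1 : rep_fun 1 = \1%VF;
  repM : forall a b, rep_fun (a * b) = (rep_fun a \o rep_fun b)%VF
}.

Definition degree (V : vectType F) (rho : representation V) : nat := \dim {:V}.

Section OneRepresentation.
Variables (V : vectType F) (rho : representation V).

Definition subrepresentation (U : {vspace V}) : Prop :=
  forall a v, v \in U -> rho a v \in U.

Definition irreducible : Prop :=
  {:V}%VS <> 0%VS /\
  forall U, subrepresentation U -> U = 0%VS \/ U = {:V}%VS.

Definition completely_reducible : Prop :=
  forall U, subrepresentation U ->
  exists W, [/\ subrepresentation W, (U + W)%VS = {:V}%VS & (U :&: W)%VS = 0%VS].

Definition rep_endomorphism (f : 'End(V)) : Prop :=
  forall a, (f \o rho a)%VF = (rho a \o f)%VF.

End OneRepresentation.

Lemma regular_rep1 : amull 1 = \1%VF :> 'End(A).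
Proof. exact: amull1. Qed.

Lemma regular_repM (a b : A) : amull (a * b) = (amull a \o amull b)%VF.
Proof. exact: amullM. Qed.

Definition regular_rep : representation A :=
  @Representation A (@amull F A) regular_rep1 regular_repM.

Definition semisimple : Prop := completely_reducible regular_rep.

Definition split_semisimple : Prop :=
  semisimple /\
  forall (V : vectType F) (rho : representation V), irreducible rho ->
  forall f : 'End(V), rep_endomorphism rho f -> exists k : F, f = k *: \1%VF.

End Representations.

Section Casimir.
Variables (F : fieldType) (A : falgType F) (lambda : {scalar A}).

Definition two_sided_ideal (I : {vspace A}) : Prop :=
  forall a x, x \in I -> a * x \in I /\ x * a \in I.

Definition frobenius_trace_form : Prop :=
  (forall a b, lambda (a * b) = lambda (b * a)) /\
  (forall I, two_sided_ideal I -> (forall x, x \in I -> lambda x = 0) -> I = 0%VS).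

Local Notation e := (vbasis {:A}).

Definition gram_mx : 'M[F]_(\dim {:A}) := \matrix_(i, j) lambda (e`_i * e`_j).

(* The basis dual to e with respect to lambda, see dual_basisP. *)
Definition dual_basis (j : 'I_(\dim {:A})) : A :=
  \sum_k (invmx gram_mx) k j *: e`_k.

(* c_lambda, written with a pair of dual bases; casimirP is its intrinsic
   characterization. *)
Definition casimir : tensor A A := \sum_(i < \dim {:A}) tens e`_i (dual_basis i).

Definition casimir_trace (a : A) : A := \sum_(i < \dim {:A}) e`_i * a * dual_basis i.

Lemma casimir_traceE a :
  casimir_trace a = tens_lift (fun x y => x * a * y) casimir.
Proof.
rewrite linear_sum; apply: eq_bigr => i _; rewrite /= tens_lift_tens // => [y|x] k u v.
  by rewrite !mulrDl !scalerAl.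
by rewrite mulrDr scalerAr.
Qed.

Hypothesis frob : frobenius_trace_form.

Lemma frobenius_nondegenerate x : (forall a, lambda (x * a) = 0) -> x = 0.
Proof.
case: frob => tr nz x0; pose I := ({:A} * (<[x]> * {:A}))%VS.
have I0 : I = 0%VS.
  apply: nz => [a u uI|].
    split; first by apply: (subvP (_ : {:A} * I <= I)%VS);
      rewrite ?memv_mul ?memvf // prodvA prodvSl ?subvf.
    by apply: (subvP (_ : I * {:A} <= I)%VS);
      rewrite ?memv_mul ?memvf // -!prodvA !prodvSr ?subvf.
  pose l : 'Hom(A, F^o) := linfun (lambda : {linear A -> F^o}).
  suff /subvP h : (I <= lker l)%VS by move=> u /h; rewrite memv_ker lfunE => /eqP.
  apply/prodvP=> a u _ uI; rewrite memv_ker lfunE /= tr.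
  suff : u \in lker (l \o amulr a)%VF.
    by rewrite memv_ker comp_lfunE !lfunE.
  apply: (subvP _ _ uI); apply/prodvP=> _ b /vlineP[k ->] _.
  rewrite memv_ker comp_lfunE !lfunE /= -mulrA -scalerAl linearZ /= x0.
  by rewrite ?mulr0 ?scaler0.
have : 1 * (x * 1) \in I by rewrite !memv_mul ?memvf ?memv_line.
by rewrite I0 mul1r mulr1 memv0 => /eqP.
Qed.

Lemma gram_mx_unit : gram_mx \in unitmx.
Proof.
rewrite -row_free_unit -kermx_eq0; apply/rowV0P=> u /sub_kermxP uG.
pose x := \sum_i u 0 i *: e`_i.
have x0 : x = 0.
  apply: frobenius_nondegenerate => a.
  rewrite (coord_vbasis (memvf a)) mulr_sumr linear_sum big1 // => j _.
  rewrite -scalerAr linearZ /= [X in _ * X](_ : _ = (u *m gram_mx) 0 j).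
    by rewrite uG mxE mulr0.
  rewrite mxE mulr_suml linear_sum; apply: eq_bigr => i _.
  by rewrite -scalerAl linearZ mxE.
apply/rowP=> i; rewrite mxE.
have : coord e i x = 0 by rewrite x0 linear0.
rewrite linear_sum (bigD1 i) //= linearZ /= coord_vbasis_nth eqxx mulr1 big1 ?addr0 //.
by move=> j ji; rewrite linearZ /= coord_vbasis_nth eq_sym (negPf ji) mulr0.
Qed.

Lemma dual_basisP (i j : 'I_(\dim {:A})) :
  lambda (e`_i * dual_basis j) = (i == j)%:R.
Proof.
have /matrixP/(_ i j) := mulmxV gram_mx_unit; rewrite !mxE => <-.
rewrite mulr_sumr linear_sum; apply: eq_bigr => k _.
by rewrite -scalerAr linearZ /= !mxE mulrC.
Qed.

Lemma casimirP (c : tensor A A) :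
  c = casimir <->
  (forall a, a = tens_lift (fun x y => lambda (a * y) *: x) c).
Proof.
have ex a : a = tens_lift (fun x y => lambda (a * y) *: x) casimir.
  rewrite linear_sum {1}(coord_vbasis (memvf a)); apply: eq_bigr => i _.
  rewrite /= tens_lift_tens => [|y k u v|x k u v]; first last.
  - by rewrite mulrDr -scalerAr linearP scalerDl scalerA.
  - by rewrite scalerDr !scalerA mulrC.
  congr (_ *: _); rewrite {2}(coord_vbasis (memvf a)) mulr_suml linear_sum.
  rewrite (bigD1 i) //= -scalerAl linearZ /= dual_basisP eqxx mulr1 big1 ?addr0 //.
  by move=> j ji; rewrite -scalerAl linearZ /= dual_basisP (negPf ji) mulr0.
split=> [-> //|hc]; apply/eqP; rewrite -subr_eq0.
have d0 a : tens_lift (fun x y => lambda (a * y) *: x) (c - casimir) = 0.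
  by rewrite linearB /= -hc -ex subrr.
set d := c - casimir in d0 *.
suff dG : (d : 'M_(_, _)) *m gram_mx^T = 0.
  have Gt : gram_mx^T \in unitmx by rewrite unitmx_tr gram_mx_unit.
  by apply/eqP; rewrite -[LHS](mulmxK Gt) dG mul0mx.
apply/matrixP=> i k; have /(congr1 (coord e i)) := d0 e`_k.
rewrite linear0 /tens_lift linear_sum (bigD1 i) //= [X in _ + X]big1 ?addr0 => [|j ji].
  rewrite linear_sum !mxE => h; rewrite -[RHS]h; apply: eq_bigr => j _.
  by rewrite !linearZ /= coord_vbasis_nth eqxx !mxE mulr1.
rewrite linear_sum big1 // => l _.
by rewrite !linearZ /= coord_vbasis_nth eq_sym (negPf ji) !mulr0.
Qed.

Lemma casimir_trace_center a : casimir_trace a \in 'Z({:A})%VS.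
Proof.
have [tr _] := frob.
have dualE (y : A) : y = \sum_(i < \dim {:A}) lambda (e`_i * y) *: dual_basis i.
  apply/eqP; rewrite -subr_eq0; apply/eqP/frobenius_nondegenerate => b.
  rewrite tr (coord_vbasis (memvf b)) mulr_suml linear_sum big1 // => k _.
  rewrite -scalerAl linearZ mulrBr linearB mulr_sumr [X in _ - X]linear_sum /=.
  rewrite (bigD1 k) //= -scalerAr linearZ /= dual_basisP eqxx mulr1 big1 => [|i ik].
    by rewrite addr0 subrr mulr0.
  by rewrite -scalerAr linearZ /= dual_basisP eq_sym (negPf ik) mulr0.
have elE x : x = \sum_(i < \dim {:A}) lambda (x * dual_basis i) *: e`_i.
  rewrite [LHS](proj1 (casimirP casimir) erefl) linear_sum; apply: eq_bigr => i _.
  rewrite /= tens_lift_tens // => [y k u v|z k u v].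
    by rewrite scalerDr !scalerA mulrC.
  by rewrite mulrDr -scalerAr linearP scalerDl scalerA.
rewrite memv_cap memvf /=; apply/centvP=> b _.
pose h (i j : 'I_(\dim {:A})) :=
  lambda (b * e`_j * dual_basis i) *: (e`_i * a * dual_basis j).
rewrite /casimir_trace mulr_suml mulr_sumr.
transitivity (\sum_i \sum_j h i j).
  apply: eq_bigr => i _; rewrite -[_ * b]mulrA (dualE (dual_basis i * b)) mulr_sumr.
  by apply: eq_bigr => j _; rewrite -scalerAr /h mulrA tr mulrA.
rewrite exchange_big; apply: eq_bigr => j _ /=.
rewrite !mulrA (elE (b * e`_j)) !mulr_suml; apply: eq_bigr => i _.
by rewrite -!scalerAl.
Qed.

End Casimir.

(* Main.v *)
From HB Require Import structures.
Require Import Defs.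
From mathcomp Require Import all_boot all_order all_algebra all_field.

Set Implicit Arguments.
Unset Strict Implicit.
Unset Printing Implicit Defensive.

Import GRing.Theory Num.Theory.
Local Open Scope ring_scope.

(* Schur's lemma and a trace computation give, in an irreducible representation
   of degree n, [sum_i x_i M y_i = (z / n) tr M] for every matrix M, where
   z = gamma_lambda(1).  Hence c_lambda acts on V (x) V as z / n times the swap
   of the two factors, so an integral equation of c_lambda is one of the rational
   number z / n.  Conversely, let w be the element of A that represents the
   character of V with respect to lambda.  On V (x) A the square of c_lambda acts
   as (z / n)(1 (x) w), and w^2 = (z / n) w, so c_lambda is annihilated there by
   X^2 (X^2 - (z / n)^2).  Since A is a sum of irreducible left ideals, c_lambda
   is a root of the product of the polynomials X^2 (X^2 - i^2), 0 <= i <= |z|. *)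

(** * Rational roots of monic integer polynomials *)

Lemma pchar0_intr_eq0 (F : fieldType) (m : int) :
  [pchar F] =i pred0 -> (m%:~R == 0 :> F) = (m == 0).
Proof.
by move=> /pcharf0P charF; case: m => n; rewrite ?NegzE ?rmorphN ?oppr_eq0 charF.
Qed.

(** The rational root theorem inside [F], whose prime field is the rationals: in lowest terms
    [m' / d'], the denominator divides a power of the coprime numerator, so it is a unit. *)
Lemma integral_root_dvdz (F : fieldType) (m d : int) (p : {poly int}) :
  [pchar F] =i pred0 -> d != 0 -> p \is monic ->
  root (map_poly intr p) (m%:~R / d%:~R : F) -> (d %| m)%Z.
Proof.
move=> charF d0 pmon.
have intr0 k : (k%:~R == 0 :> F) = (k == 0) by apply: pchar0_intr_eq0.
have intr_inj : injective (intr : int -> F).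
  by move=> x y /eqP; rewrite -subr_eq0 -rmorphB intr0 subr_eq0 => /eqP.
have g0 : gcdz m d != 0 by rewrite gcdz_eq0 negb_and d0 orbT.
have [[m' m'E] [d' d'E]] := (dvdzP (dvdz_gcdl m d), dvdzP (dvdz_gcdr m d)).
have d'0 : d' != 0 by apply: contraNneq d0 => h; rewrite d'E h mul0r.
have cop : coprimez d' m'.
  have [u [v uv]] := Bezoutz m d; rewrite coprimez_sym; apply/coprimezP.
  exists (u, v); apply: (mulIf g0) => /=.
  by rewrite mul1r mulrDl -!mulrA -m'E -d'E.
have -> : m%:~R / d%:~R = m'%:~R / d'%:~R :> F.
  rewrite m'E [in X in _ / X]d'E !rmorphM /= -mulf_div divff ?mulr1 //.
  by rewrite intr0.
move=> /rootP; rewrite horner_coef size_map_inj_poly ?rmorph0 //.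
have : lead_coef p = 1 by apply/eqP.
have : size p != 0%N by rewrite size_poly_eq0 monic_neq0.
rewrite lead_coefE; case: (size p) => [//|n] /= _ pn1 p0.
(* Clear denominators and pull the equation back to the integers. *)
have pE : \sum_(i < n.+1) p`_i * m' ^+ i * d' ^+ (n - i) = 0.
  apply: intr_inj; rewrite rmorph_sum rmorph0 /=.
  rewrite -[RHS](mul0r (d'%:~R ^+ n)) -[X in _ = X * _]p0 mulr_suml.
  apply: eq_bigr => i _.
  rewrite !rmorphM !rmorphXn /= coef_map expr_div_n -!mulrA; congr (_ * (_ * _)).
  rewrite -[X in _ = _ * _ ^+ X](subnK (leq_ord i)) exprD mulrCA mulVf.
    by rewrite mulr1.
  by rewrite expf_neq0 ?intr0.
(* Every term except the leading one carries a factor [d']. *)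
have d'_dvd : (d' %| m' ^+ n)%Z.
  move/eqP: pE; rewrite big_ord_recr /= pn1 mul1r subnn mulr1 addr_eq0 => /eqP E.
  rewrite -[m' ^+ n]opprK -E rpredN rpred_sum // => i _.
  by rewrite dvdz_mull // -(subnSK (ltn_ord i)) exprS dvdz_mulr.
rewrite m'E [X in (X %| _)%Z]d'E dvdz_mul //.
rewrite (dvdz_trans _ (dvd1z m')) //.
by rewrite -(Gauss_dvdzr 1 (coprimezXr n cop)) mulr1.
Qed.

(** * Commutation rules for the Casimir element *)

Section CasimirCommutation.
Variables (F : fieldType) (A : falgType F) (lambda : {scalar A}).
Hypothesis frob : frobenius_trace_form lambda.
Local Notation e := (vbasis {:A}).
Local Notation d := (dual_basis lambda).
Local Notation c := (casimir lambda).

Lemma basis_expansion (a : A) :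
  a = \sum_(i < \dim {:A}) lambda (a * d i) *: e`_i.
Proof.
rewrite [LHS](proj1 (casimirP frob c) erefl) linear_sum.
apply: eq_bigr => i _; rewrite /= tens_lift_tens // => [y k u v|x k u v].
  by rewrite scalerDr !scalerA mulrC.
by rewrite mulrDr -scalerAr linearP scalerDl scalerA.
Qed.

Lemma dual_basis_expansion (a : A) :
  a = \sum_(i < \dim {:A}) lambda (e`_i * a) *: d i.
Proof.
have [tr _] := frob; apply/eqP; rewrite -subr_eq0; apply/eqP.
apply: (frobenius_nondegenerate frob) => b.
rewrite tr mulrBr linearB {1}(basis_expansion b) mulr_suml mulr_sumr /=.
rewrite !linear_sum /= -sumrB big1 // => i _.
by rewrite -scalerAl -scalerAr !linearZ /= mulrC subrr.
Qed.

Lemma tensZl (B : falgType F) k (a : A) (b : B) : tens (k *: a) b = k *: tens a b.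
Proof. exact: (scalable_linear (tens_linl b)). Qed.

Lemma tensZr (B : falgType F) k (a : A) (b : B) : tens a (k *: b) = k *: tens a b.
Proof. exact: (scalable_linear (tens_linr a)). Qed.

Lemma tens_suml (B : falgType F) I r (P : pred I) (f : I -> A) (b : B) :
  tens (\sum_(i <- r | P i) f i) b = \sum_(i <- r | P i) tens (f i) b.
Proof.
apply/matrixP=> i j; rewrite summxE mxE linear_sum mulr_suml.
by apply: eq_bigr => k _; rewrite mxE.
Qed.

Lemma tens_sumr (B : falgType F) I r (P : pred I) (a : A) (f : I -> B) :
  tens a (\sum_(i <- r | P i) f i) = \sum_(i <- r | P i) tens a (f i).
Proof.
apply/matrixP=> i j; rewrite summxE mxE linear_sum mulr_sumr.
by apply: eq_bigr => k _; rewrite mxE.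
Qed.

(** Expanding [b * e_j] in the basis and [d_i * b] in the dual basis gives the same coefficients,
    because [lambda] is a trace form. *)
Lemma casimir_comml b : tens b 1 * c = c * tens 1 b.
Proof.
have [tr _] := frob.
rewrite mulr_sumr mulr_suml.
transitivity (\sum_i \sum_(j < \dim {:A})
                lambda (b * e`_j * d i) *: tens e`_i (d j)).
  rewrite [RHS]exchange_big; apply: eq_bigr => j _.
  rewrite tensM mul1r [in LHS](basis_expansion (b * e`_j)) tens_suml.
  by apply: eq_bigr => i _; rewrite tensZl.
apply: eq_bigr => i _.
rewrite tensM mulr1 [in RHS](dual_basis_expansion (d i * b)) tens_sumr.
by apply: eq_bigr => j _; rewrite tensZr -mulrA tr -mulrA.
Qed.

Lemma casimir_commr b : tens 1 b * c = c * tens b 1.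
Proof.
have [tr _] := frob.
rewrite mulr_sumr mulr_suml.
transitivity (\sum_i \sum_(j < \dim {:A})
                lambda (e`_j * b * d i) *: tens e`_i (d j)).
  apply: eq_bigr => i _.
  rewrite tensM mul1r [in LHS](dual_basis_expansion (b * d i)) tens_sumr.
  by apply: eq_bigr => j _; rewrite tensZr mulrA.
rewrite [LHS]exchange_big; apply: eq_bigr => j _.
rewrite tensM mulr1 [in RHS](basis_expansion (e`_j * b)) tens_suml.
by apply: eq_bigr => i _; rewrite tensZl.
Qed.

(** This reflects the symmetry of the Casimir element under exchange of the two factors, which comes
    from the symmetric form [lambda (a * b)]. *)
Lemma sum_dual_basisM : \sum_i d i * e`_i = casimir_trace lambda 1.
Proof.
have [tr _] := frob.
transitivity (\sum_i \sum_(j < \dim {:A}) lambda (d i * d j) *: (e`_j * e`_i)).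
  apply: eq_bigr => i _; rewrite {1}(basis_expansion (d i)) mulr_suml.
  by apply: eq_bigr => j _; rewrite -scalerAl.
rewrite [LHS]exchange_big; apply: eq_bigr => j _.
rewrite /= mulr1 [in RHS](basis_expansion (d j)) mulr_sumr.
by apply: eq_bigr => i _; rewrite -scalerAr tr.
Qed.

(** Split the first [c] into [(e_i (x) 1) (1 (x) d_i)] and move [1 (x) d_i] across the second one:
    it becomes a right factor [d_i (x) 1], which closes up the Casimir trace. *)
Lemma casimir_sqr :
  c * c = \sum_(j < \dim {:A}) tens (casimir_trace lambda e`_j) (d j).
Proof.
rewrite {1}/casimir mulr_suml.
transitivity (\sum_(i < \dim {:A}) \sum_(j < \dim {:A})
                tens (e`_i * e`_j * d i) (d j)).
  apply: eq_bigr => i _; rewrite -[tens _ _](_ : tens e`_i 1 * tens 1 (d i) = _).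
    rewrite -mulrA casimir_commr mulr_suml mulr_sumr.
    by apply: eq_bigr => j _; rewrite !tensM mul1r mulr1 mulrA.
  by rewrite tensM mulr1 mul1r.
by rewrite [LHS]exchange_big; apply: eq_bigr => j _; rewrite -tens_suml.
Qed.

Section CasimirBilinear.
Variables (V : lmodType F) (f : A -> A -> V).
Hypotheses (fl : forall y, linear (f^~ y)) (fr : forall x, linear (f x)).

Lemma casimir_lift : tens_lift f c = \sum_(i < \dim {:A}) f e`_i (d i).
Proof. by rewrite linear_sum; apply: eq_bigr => i _ /=; rewrite tens_lift_tens. Qed.

Lemma casimir_bilinear_comml b :
  \sum_(i < \dim {:A}) f (b * e`_i) (d i)
    = \sum_(i < \dim {:A}) f e`_i (d i * b).
Proof.
have := congr1 (tens_lift f) (casimir_comml b).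
rewrite mulr_sumr mulr_suml !linear_sum => cE.
transitivity (\sum_(i < \dim {:A}) tens_lift f (tens b 1 * tens e`_i (d i))).
  by apply: eq_bigr => i _; rewrite tensM mul1r tens_lift_tens.
rewrite [LHS]cE; apply: eq_bigr => i _.
by rewrite [_ * tens _ _]tensM mulr1 /= tens_lift_tens.
Qed.

Lemma casimir_bilinear_commr b :
  \sum_(i < \dim {:A}) f e`_i (b * d i)
    = \sum_(i < \dim {:A}) f (e`_i * b) (d i).
Proof.
have := congr1 (tens_lift f) (casimir_commr b).
rewrite mulr_sumr mulr_suml !linear_sum => cE.
transitivity (\sum_(i < \dim {:A}) tens_lift f (tens 1 b * tens e`_i (d i))).
  by apply: eq_bigr => i _; rewrite tensM mul1r tens_lift_tens.
rewrite [LHS]cE; apply: eq_bigr => i _.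
by rewrite [_ * tens _ _]tensM mulr1 /= tens_lift_tens.
Qed.

End CasimirBilinear.

End CasimirCommutation.

(** * The Casimir element in a matrix representation satisfying Schur's lemma *)

Section MatrixRepresentation.
Variables (F : fieldType) (A : falgType F) (lambda : {scalar A}) (z : F).
Hypotheses (frob : frobenius_trace_form lambda).
Hypothesis trace1 : casimir_trace lambda 1 = z%:A.
Variables (n : nat) (R : {linear A -> 'M[F]_n}).
Hypotheses (R1 : R 1 = 1%:M) (RM : forall a b, R (a * b) = R a *m R b).
Hypothesis schur : forall M : 'M[F]_n,
  (forall a, M *m R a = R a *m M) -> exists k, M = k%:M.
Hypothesis n_neq0 : n%:R != 0 :> F.
Local Notation e := (vbasis {:A}).
Local Notation d := (dual_basis lambda).
Local Notation c := (casimir lambda).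

(** The sum commutes with every [R a] by [casimir_bilinear_comml], hence is a scalar matrix;
    comparing traces determines the scalar. *)
Lemma casimir_average (M : 'M[F]_n) :
  \sum_(i < \dim {:A}) R e`_i *m M *m R (d i) = (z / n%:R * \tr M)%:M.
Proof.
pose f x y := R x *m M *m R y.
have fl y : linear (f^~ y).
  by move=> k u v; rewrite /f linearP !mulmxDl -!scalemxAl.
have fr x : linear (f x).
  by move=> k u v; rewrite /f linearP mulmxDr -scalemxAr.
have [a|k kE] := schur (M := \sum_(i < \dim {:A}) f e`_i (d i)).
  rewrite mulmx_suml mulmx_sumr.
  transitivity (\sum_(i < \dim {:A}) f e`_i (d i * a)).
    by apply: eq_bigr => i _; rewrite /f RM !mulmxA.
  rewrite -casimir_bilinear_comml //; apply: eq_bigr => i _.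
  by rewrite /f RM !mulmxA.
rewrite [LHS]kE; congr (_%:M); apply: (mulIf n_neq0).
rewrite mulrAC divfK // mulr_natr -mxtrace_scalar -kE raddf_sum /=.
transitivity (\tr (M *m R (\sum_i d i * e`_i))).
  rewrite linear_sum mulmx_sumr raddf_sum; apply: eq_bigr => i _ /=.
  by rewrite /f RM mulmxA [RHS]mxtrace_mulC mulmxA.
by rewrite sum_dual_basisM // trace1 linearZ /= R1 -scalemxAr mulmx1 linearZ.
Qed.

(** Schur orthogonality of matrix coefficients, read off from [casimir_average] at the matrix unit
    [delta_mx j k]. *)
Lemma casimir_swap (i j k l : 'I_n) :
  \sum_(t < \dim {:A}) R e`_t i j * R (d t) k l
    = z / n%:R *+ ((i == l) && (j == k)).
Proof.
have /matrixP/(_ i l) := casimir_average (delta_mx j k).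
have -> : \tr (delta_mx j k : 'M[F]_n) = (j == k)%:R.
  rewrite -(mul_delta_mx (0 : 'I_1)) mxtrace_mulC mul_delta_mx_cond.
  by rewrite raddfMn /= trace_mx11 mxE !eqxx eq_sym.
rewrite summxE mxE => tE.
transitivity (z / n%:R * ((j == k)%:R) *+ (i == l)).
  rewrite -tE; apply: eq_bigr => t _.
  rewrite -(mul_delta_mx (0 : 'I_1)) !mulmxA -mulmxA.
  by rewrite -colE -rowE mxE big_ord1 !mxE.
by rewrite mulr_natr -mulrnA mulnb andbC.
Qed.

(** When V (x) V is identified with matrices, the swap is transposition and the identity matrix is a
    symmetric tensor, hence an eigenvector. *)
Lemma casimir_diag (i l : 'I_n) :
  (\sum_(t < \dim {:A}) R e`_t *m (R (d t))^T) i l = z / n%:R *+ (i == l).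
Proof.
rewrite summxE.
transitivity (\sum_(t < \dim {:A}) \sum_j R e`_t i j * R (d t) l j).
  by apply: eq_bigr => t _; rewrite mxE; apply: eq_bigr => j _; rewrite mxE.
rewrite exchange_big /= (bigD1 l) //= casimir_swap eqxx andbT big1 ?addr0 //.
by move=> j jl; rewrite casimir_swap (negPf jl) andbF.
Qed.

(* The algebra [A (x) A] acts on matrices by [(a (x) b) M = R a M (R b)^T], and
   [c 1 = (z / n) 1] by [casimir_diag]. *)
Lemma casimir_root (p : {poly int}) :
  root (map_poly intr p) c -> root (map_poly intr p) (z / n%:R).
Proof.
move=> /rootP pc.
have n_gt0 : (0 < n)%N by rewrite lt0n; apply: contraNneq n_neq0 => ->.
pose f (M : 'M[F]_n) a b := R a *m M *m (R b)^T.
have fl M y : linear (f M ^~ y).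
  by move=> k u v; rewrite /f linearP !mulmxDl -!scalemxAl.
have fr M x : linear (f M x).
  by move=> k u v; rewrite /f linearP linearP mulmxDr -scalemxAr.
pose act t M := tens_lift (f M) t.
have fM k M N a b : f (k *: M + N) a b = k *: f M a b + f N a b.
  by rewrite /f linearP /= mulmxDl -scalemxAl.
(* Both sides are linear in [s] and in [t], so pure tensors suffice. *)
have actM s t M : act (s * t) M = act s (act t M).
  rewrite -[LHS]/((tens_lift (f M) \o tens_mulr t) s) /act.
  move: s; apply: tens_ext => a b /=; rewrite /tens_mulr tens_lift_tens //.
  pose g : {linear 'M[F]_n -> 'M[F]_n} := HB.pack (fun N => f N a b)
    (GRing.isLinear.Build _ _ _ _ _ (fun k N N' => fM k N N' a b)).
  rewrite -[LHS]/((tens_lift (f M) \o tens_mul (tens a b)) t).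
  rewrite -[RHS]/((g \o tens_lift (f M)) t).
  move: t; apply: tens_ext => a' b' /=.
  rewrite tens_mul_tens !tens_lift_tens // /g /= /f !RM trmx_mul.
  by rewrite !mulmxA.
have act1 M : act 1 M = M.
  by rewrite /act tens_lift_tens // /f R1 mul1mx trmx1 mulmx1.
have act_c k : act c k%:M = (z / n%:R * k)%:M.
  rewrite /act casimir_lift //; apply/matrixP=> i l.
  rewrite [RHS]mxE mulrC -mulrnAr -casimir_diag !summxE mulr_sumr.
  by apply: eq_bigr => t _; rewrite /f mul_mx_scalar -scalemxAl mxE.
have actX k : act (c ^+ k) 1%:M = ((z / n%:R) ^+ k)%:M.
  by elim: k => [|k IHk]; rewrite ?act1 // exprS actM IHk act_c exprS.
(* Apply p(c) = 0 to the eigenvector [1%:M]. *)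
have : act 0 1%:M = (map_poly intr p).[z / n%:R]%:M.
  transitivity (act (map_poly intr p).[c] 1%:M).
    by congr (act _ _); apply: esym; exact: pc.
  rewrite /map_poly !horner_poly raddf_sum /act linear_sum.
  apply: eq_bigr => i _.
  rewrite mulrzl -[_ *~ _]scaler_int linearZ /= -[tens_lift _ _]/(act _ _) actX.
  by rewrite scale_scalar_mx.
rewrite /act linear0 => /matrixP/(_ (Ordinal n_gt0) (Ordinal n_gt0)).
by rewrite !mxE eqxx mulr1n => /esym/rootP.
Qed.

(** By duality of the bases, [w] is the element with [lambda (a * w) = \tr (R a)] for all [a]. *)
Let w := \sum_(t < \dim {:A}) \tr (R e`_t) *: d t.

Lemma rep_char_dual : R w = (z / n%:R)%:M.
Proof.
apply/matrixP=> k l; rewrite mxE linear_sum summxE.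
transitivity (\sum_(t < \dim {:A}) \sum_i R e`_t i i * R (d t) k l).
  by apply: eq_bigr => t _; rewrite linearZ mxE -mulr_suml.
rewrite exchange_big /= (bigD1 l) //= casimir_swap eqxx.
rewrite big1 ?addr0 ?[l == k]eq_sym //.
by move=> j jl; rewrite casimir_swap (negPf jl).
Qed.

(** Moving [w] from the dual basis to the basis puts it inside the character, where [R w] is a
    scalar. *)
Lemma char_dual_sqr : w * w = (z / n%:R) *: w.
Proof.
pose f x y := \tr (R x) *: (y : A).
have fl y : linear (f^~ y).
  by move=> k u v; rewrite /f !linearP scalerDl scalerA.
have fr x : linear (f x).
  by move=> k u v; rewrite /f scalerDr !scalerA mulrC.
rewrite {2}/w mulr_sumr.
transitivity (\sum_(i < \dim {:A}) f e`_i (w * d i)).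
  by apply: eq_bigr => i _; rewrite -scalerAr.
rewrite (casimir_bilinear_commr frob fl fr) scaler_sumr; apply: eq_bigr => i _.
by rewrite /f RM rep_char_dual mul_mx_scalar linearZ scalerA.
Qed.

Lemma rep_casimir_trace a :
  R (casimir_trace lambda a) = (z / n%:R * \tr (R a))%:M.
Proof.
rewrite -casimir_average linear_sum; apply: eq_bigr => i _.
by rewrite !RM.
Qed.

(** The hypothesis on [x] holds for vectors of a left ideal that affords [R]; only the action of
    elements with scalar image is needed, since the first factors of [c * c] are Casimir traces. *)
Lemma casimir_sqr_sqr (x : A) :
  (forall a b, R a = b%:M -> a * x = b *: x) ->
  (c * c - ((z / n%:R) ^+ 2)%:A) * (c * c) * tens x 1 = 0.
Proof.
move=> Rx.
(* Each Casimir trace acts on [x] as z / n times a character value, and these values assemble to [w]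
   in the second factor. *)
have c2 (y : A) : c * c * tens x y = (z / n%:R) *: tens x (w * y).
  rewrite casimir_sqr // mulr_suml mulr_suml tens_sumr scaler_sumr.
  apply: eq_bigr => t _.
  rewrite tensM (Rx _ _ (rep_casimir_trace _)) !tensZl -scalerAl tensZr.
  by rewrite scalerA.
rewrite -mulrA c2 mulr1 -scalerAr mulrBl c2 mulr_algl.
by rewrite char_dual_sqr tensZr scalerA subrr scaler0.
Qed.

End MatrixRepresentation.

(** * From representations to matrices *)

Import passmx.

Section RepresentationMatrix.
Variables (F : fieldType) (A : falgType F) (V : vectType F).
Variable rho : representation A V.
Local Notation e := (vbasis {:V}).
Local Notation mx_of := (mxof e e).

Let mx_ofK : cancel mx_of (hommx e e).
Proof. exact: mxofK (vbasisP _) (vbasisP _). Qed.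

Let mx_of1 : mx_of \1%VF = 1%:M.
Proof. by rewrite mxof1 // (basis_free (vbasisP _)). Qed.

Let mx_of_comp (f g : 'End(V)) : mx_of (f \o g)%VF = mx_of g *m mx_of f.
Proof. by rewrite (mxof_comp e e (vbasisP _)). Qed.

(* [mxof] acts on row vectors and reverses products, hence the transpose. *)
Definition rep_mx (a : A) : 'M[F]_(degree rho) := (mx_of (rho a))^T.

Lemma rep_mx_linear : linear rep_mx.
Proof. by move=> k a b; rewrite /rep_mx linearP linearP linearP. Qed.

HB.instance Definition _ :=
  GRing.isLinear.Build F A 'M[F]_(degree rho) _ rep_mx rep_mx_linear.

Lemma rep_mx1 : rep_mx 1 = 1%:M.
Proof. by rewrite /rep_mx rep1 mx_of1 trmx1. Qed.

Lemma rep_mxM a b : rep_mx (a * b) = rep_mx a *m rep_mx b.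
Proof. by rewrite /rep_mx repM mx_of_comp trmx_mul. Qed.

Lemma rep_mx_scalar a k : rep_mx a = k%:M -> rho a = k *: \1%VF.
Proof.
move=> aE; apply: (can_inj mx_ofK); apply: trmx_inj; rewrite -[LHS]/(rep_mx a).
by rewrite aE linearZ /= mx_of1 scalemx1 tr_scalar_mx.
Qed.

Lemma rep_mx_schur (M : 'M[F]_(degree rho)) :
  (forall f, rep_endomorphism rho f -> exists k : F, f = k *: \1%VF) ->
  (forall a, M *m rep_mx a = rep_mx a *m M) -> exists k, M = k%:M.
Proof.
have fK : mx_of (hommx e e M^T) = M^T := hommxK (vbasisP _) (vbasisP _) M^T.
move=> schur Mrho; have [a|k kE] := schur (hommx e e M^T).
  apply: (can_inj mx_ofK); apply: trmx_inj.
  by rewrite !mx_of_comp fK !trmx_mul trmxK Mrho.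
exists k; apply: trmx_inj; rewrite -fK kE linearZ /= mx_of1.
by rewrite scalemx1 tr_scalar_mx.
Qed.

End RepresentationMatrix.

(** * Irreducible left ideals of a semisimple algebra *)

Section IrreducibleIdeals.
Variables (F : fieldType) (A : falgType F).

Section Restriction.
Variable L : {vspace A}.
Hypothesis Lsub : subrepresentation (regular_rep A) L.

Lemma left_idealM a x : x \in L -> a * x \in L.
Proof. by move=> /(Lsub a); rewrite lfunE. Qed.

(** Since [L] is stable under left multiplication, [vsproj L] only changes the type here. *)
Definition restr_fun (a : A) : 'End(subvs_of L) :=
  linfun (vsproj L \o amull a \o vsval).

Lemma restr_funE a u : vsval (restr_fun a u) = a * vsval u.
Proof. by rewrite lfunE /= lfunE /= vsprojK // left_idealM ?subvsP. Qed.

Lemma restr_fun_linear : linear restr_fun.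
Proof.
move=> k a b; apply/lfunP=> u; apply: subvs_inj.
rewrite add_lfunE scale_lfunE restr_funE linearP /= !restr_funE.
by rewrite mulrDl scalerAl.
Qed.

HB.instance Definition _ :=
  GRing.isLinear.Build F A 'End(subvs_of L) _ restr_fun restr_fun_linear.

Lemma restr_fun1 : restr_fun 1 = \1%VF.
Proof.
by apply/lfunP=> u; apply: subvs_inj; rewrite restr_funE id_lfunE mul1r.
Qed.

Lemma restr_funM a b : restr_fun (a * b) = (restr_fun a \o restr_fun b)%VF.
Proof.
by apply/lfunP=> u; apply: subvs_inj; rewrite comp_lfunE !restr_funE mulrA.
Qed.

Definition restr_rep : representation A (subvs_of L) :=
  Representation restr_fun1 restr_funM.

Lemma restr_rep_irreducible :
    L != 0%VS ->
    (forall U, subrepresentation (regular_rep A) U -> (U <= L)%VS ->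
       U = 0%VS \/ U = L) ->
  irreducible restr_rep.
Proof.
move=> L0 Lmin; split.
  move=> /eqP; rewrite -dimv_eq0 dimvf => /eqP L00.
  by move: L0; rewrite -dimv_eq0 => /eqP.
move=> U Usub; pose U' := (linfun (vsval (U := L)) @: U)%VS.
have memU' v : v \in U -> vsval v \in U'.
  by move=> vU; rewrite -[vsval v](lfunE (vsval (U := L))) memv_img.
have U'P u : reflect (exists2 v, v \in U & u = vsval v) (u \in U').
  apply: (iffP memv_imgP) => -[v vU ->]; exists v => //; last by rewrite lfunE.
  by rewrite lfunE.
have [| |U0|UL] := Lmin U'.
- move=> a _ /U'P[v vU ->]; rewrite lfunE /= -restr_funE.
  by apply/memU'/Usub.
- by apply/subvP=> _ /U'P[v vU ->]; apply: subvsP.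
- left; apply/eqP; rewrite -subv0; apply/subvP=> v /memU'; rewrite U0 !memv0.
  by move=> /eqP v0; apply/eqP/subvs_inj.
right; apply/eqP; rewrite eqEsubv subvf /=; apply/subvP=> v _.
have /U'P[u uU /subvs_inj->//] : vsval v \in U' by rewrite UL subvsP.
Qed.

End Restriction.

(** By induction on dimension, every left ideal lies in [K]: a reducible one is a sum of two smaller
    left ideals. *)
Lemma semisimple_ideal_ind (K : {vspace A}) :
    semisimple A ->
    (forall L (Lsub : subrepresentation (regular_rep A) L),
       irreducible (restr_rep Lsub) -> (L <= K)%VS) ->
  K = {:A}%VS.
Proof.
move=> ssA Kirr; apply/eqP; rewrite eqEsubv subvf /=.
suff Ksub n U : subrepresentation (regular_rep A) U -> (\dim U < n)%N ->
    (U <= K)%VS.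
  by apply: (Ksub (\dim {:A}).+1) => // a x _; apply: memvf.
elim: n U => // n IHn U Usub Un; apply/negPn/negP => nUK.
apply/negP: (nUK); apply/negPn/(Kirr U Usub)/restr_rep_irreducible.
  by apply: contraNneq nUK => ->; apply: sub0v.
move=> W Wsub WU.
have [W0|W0] := eqVneq W 0%VS; [by left | right].
apply/eqP/negPn/negP => WneU; case/negP: nUK.
have [W' [W'sub WW' WcapW']] := ssA W Wsub.
have dim_lt X : (X <= U)%VS -> X != U -> (\dim X < n)%N.
  move=> XU XneU; apply: (leq_trans _ (Un : (\dim U <= n)%N)).
  by rewrite ltn_neqAle dimvS // (dimv_leqif_eq XU) XneU.
(* The modular law turns a complement of [W] in [A] into one in [U]. *)
have -> : U = (W + (U :&: W'))%VS.
  by rewrite capvC vspace_modl // WW' capvC; apply/esym/capv_idPl/subvf.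
rewrite subv_add !IHn ?dim_lt ?capvSl //.
  by move=> a x; rewrite !memv_cap => /andP[xU xW']; rewrite Usub // W'sub.
(* If [U] were contained in [W'], then so would be [W], forcing [W] to vanish. *)
apply: contraNneq W0 => UE; rewrite -subv0 -WcapW' subv_cap subvv.
by rewrite (subv_trans WU) // -UE capvSr.
Qed.

End IrreducibleIdeals.

(** * The equivalence of divisibility and integrality *)

Lemma degree_gt0 (F : fieldType) (A : falgType F) (V : vectType F)
    (rho : representation A V) :
  irreducible rho -> (0 < degree rho)%N.
Proof. by case=> V0 _; rewrite lt0n dimv_eq0; apply/eqP. Qed.

Theorem corollary6 (F : fieldType) (A : falgType F) (lambda : {scalar A})
    (z : int)
    (charF : [pchar F] =i pred0)
    (splitA : split_semisimple A)
    (frob : frobenius_trace_form lambda)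
    (trace1 : casimir_trace lambda 1 = z%:~R) :
  (forall (V : vectType F) (rho : representation A V),
     irreducible rho -> ((degree rho)%:Z %| z)%Z)
  <-> integralOver (intr : int -> tensor A A) (casimir lambda).
Proof.
have [ssA endA] := splitA.
have trace1F : casimir_trace lambda 1 = (z%:~R)%:A by rewrite trace1 scaler_int.
have deg_neq0 (V : vectType F) (rho : representation A V) :
    irreducible rho -> (degree rho)%:R != 0 :> F.
  by move=> /degree_gt0; rewrite (proj1 (pcharf0P F) charF) -lt0n.
have schur (V : vectType F) (rho : representation A V) irr M :=
  rep_mx_schur (M := M) (endA V rho irr).
split=> [deg_dvd | [p pmon pc] V rho irr]; last first.
  apply: (integral_root_dvdz charF _ pmon); first by rewrite -lt0n degree_gt0.
  exact: (casimir_root frob trace1F (rep_mx1 rho) (rep_mxM rho) (schur _ _ irr)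
    (deg_neq0 _ _ irr) pc).
pose c := casimir lambda.
have c_comm : commr_rmorph intr c by move=> m; apply: commr_int.
pose ev : {rmorphism {poly int} -> tensor A A} := horner_morph c_comm.
pose q (m : int) : {poly int} := ('X^2 - (m ^+ 2)%:P) * 'X^2.
have qmon m : q m \is monic.
  by rewrite monicMl ?monicXn // monicXnsubC.
pose p := \prod_(i < `|z|.+1) q i.
suff evp : ev p = 0 by exists p; [apply: monic_prod | apply/rootP].
(* The vanishing of [ev p] is tested on the elements [tens x 1]; the [x] that pass form a subspace,
   which must contain every irreducible left ideal. *)
pose f x := ev p * tens x 1.
have f_linear : linear f.
  by move=> k u v; rewrite /f tens_linl mulrDr -scalerAr.
pose fL : {linear A -> tensor A A} :=
  HB.pack f (GRing.isLinear.Build _ _ _ _ _ f_linear).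
have KE : lker (linfun fL) = {:A}%VS; last first.
  have := memvf (1 : A); rewrite -KE memv_ker lfunE /= => /eqP.
  by rewrite /f [tens 1 1 : tensor A A](_ : _ = 1) ?mulr1.
apply: (semisimple_ideal_ind ssA) => L Lsub irr.
apply/subvP=> x xL; rewrite memv_ker lfunE; apply/eqP; rewrite /= /f.
have [m zE] := dvdzP (deg_dvd _ _ irr).
set n := degree _ in zE.
have kE : z%:~R / n%:R = m%:~R :> F.
  by rewrite zE rmorphM /= mulfK ?deg_neq0.
have Rx a b : rep_mx (restr_rep Lsub) a = b%:M -> a * x = b *: x.
  move=> /rep_mx_scalar aE; have {}aE : restr_fun L a = b *: \1%VF := aE.
  rewrite -(vsprojK xL) -(restr_funE Lsub) aE.
  by rewrite scale_lfunE id_lfunE linearZ.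
have := casimir_sqr_sqr frob trace1F (rep_mx1 _) (rep_mxM _) (schur _ _ irr)
    (deg_neq0 _ _ irr) Rx.
rewrite kE => qx.
(* As z = m n with n positive, |m| is among the indices 0, ..., |z|; this includes the case z =
   0. *)
have m_lt : (`|m| < `|z|.+1)%N.
  by rewrite ltnS zE abszM leq_pmulr // degree_gt0.
(* Integer polynomials commute, so the factor of index |m| can be placed next to [tens x 1]. *)
rewrite /p (bigD1 (Ordinal m_lt)) //= mulrC rmorphM -mulrA.
suff -> : ev (q `|m|%N) = (c * c - (m%:~R ^+ 2)%:A) * (c * c).
  by rewrite qx mulr0.
rewrite rmorphM rmorphB !rmorphXn /= horner_morphX horner_morphC.
(* Only the square of [m] occurs, so its sign is irrelevant. *)
have -> : (m%:~R ^+ 2)%:A = `|m|%N%:~R ^+ 2 :> tensor A A.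
  have mE : m ^+ 2 = `|m|%N%:Z ^+ 2 by rewrite abszE real_normK ?num_real.
  by rewrite -rmorphXn /= scaler_int mE rmorphXn.
by rewrite -!expr2.
Qed.
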